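(* Suppose that the Walecki tournament $W_u$ on $2m+1\ge 7$ vertices contains an arc $a$ that lies in a unique directed triangle. Then every automorphism of $W_u$ fixes the vertex $*$. Moreover, if $W_v$ is a Walecki tournament with $W_u\cong W_v$, then any isomorphism from $W_u$ to $W_v$ must map the vertex labelled $*$ in $W_u$ to the vertex labelled $*$ in $W_v$.
   Context: Let $m\ge 1$ be an integer and $n=2m$. The vertex set is $\mathbb Z_n\cup\{*\}$ ($2m+1$ vertices). Let $C_0^+$ be the directed Hamilton cycle $*\to 0\to 1\to -1\to 2\to -2\to\cdots\to m\to *$. For $j\in\mathbb Z_n$, $C_j^+$ is the image of $C_0^+$ under the permutation fixing $*$ and sending $x\mapsto x+j$ on $\mathbb Z_n$, and $C_j^-$ is $C_j^+$ with all arcs reversed. The undirected Hamilton cycles underlying $C_0^+,\dots,C_{m-1}^+$ decompose the edges of the complete graph. For a binary string $u=u_0u_1\cdots u_{m-1}\in\{0,1\}^m$ (the signature), the Walecki tournament $W_u$ consists, for each $0\le j\le m-1$, of the arcs of $C_j^+$ if $u_j=1$ and of the arcs of $C_j^-$ if $u_j=0$. A directed triangle is a directed cycle of length $3$. Isomorphisms and automorphisms are those of directed graphs. *)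

(* Defs.v *)
From HB Require Import structures.
From mathcomp Require Import all_boot all_order all_algebra.

Set Implicit Arguments.
Unset Strict Implicit.
Unset Printing Implicit Defensive.

Import GRing.Theory.

Section Digraphs.
Variable T : finType.
Implicit Types (e : rel T) (c : seq T) (x y : T).

(* A duplicate-free sequence c = [:: x_0; ...; x_k] stands for the directed
   cycle x_0 -> ... -> x_k -> x_0. *)
Definition cycle_arc c : rel T := fun x y => (x \in c) && (next c x == y).

(* Cycles are identified with their arc sets, so the choice of a starting
   vertex is immaterial. *)
Definition directed_cycle e (k : nat) (A : {set T * T}) : Prop :=
  exists c : seq T,
    [/\ ucycle e c, size c = k & A = [set p | cycle_arc c p.1 p.2]].

Definition directed_triangle e (A : {set T * T}) : Prop :=
  directed_cycle e 3 A.

Definition in_unique_triangle e (a : T * T) : Prop :=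
  exists! A : {set T * T}, directed_triangle e A /\ a \in A.

End Digraphs.

Definition isomorphism (T T' : finType) (e : rel T) (e' : rel T')
    (f : T -> T') : Prop :=
  bijective f /\ forall x y, e' (f x) (f y) = e x y.

Definition automorphism (T : finType) (e : rel T) (f : T -> T) : Prop :=
  isomorphism e e f.

Section Walecki.
Variable m : nat.

(* None is the vertex * and Some x the vertex x of Z_(2m).  This is the
   intended vertex set only for 0 < m, since 'Z_0 is Z/2. *)
Definition vertex : finType := option 'Z_(2 * m).

Local Open Scope ring_scope.

(* 0, 1, -1, 2, -2, ..., m - 1, -(m - 1), m *)
Definition zigzag : seq 'Z_(2 * m) :=
  0 :: flatten [seq [:: i%:R; - i%:R] | i <- iota 1 m.-1] ++ [:: m%:R].

Definition C0 : seq vertex := None :: map Some zigzag.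

Definition shift (j : 'Z_(2 * m)) (x : vertex) : vertex :=
  omap (fun i => i + j) x.

Definition Cplus (j : 'Z_(2 * m)) : rel vertex :=
  cycle_arc (map (shift j) C0).

Definition Cminus (j : 'Z_(2 * m)) : rel vertex := fun x y => Cplus j y x.

Definition walecki (u : m.-tuple bool) : rel vertex := fun x y =>
  [exists j : 'I_m,
     if tnth u j then Cplus (val j)%:R x y else Cminus (val j)%:R x y].

End Walecki.

(* Main.v *)
Require Import Defs.
From mathcomp Require Import all_boot all_order all_algebra zify.

Set Implicit Arguments.
Unset Strict Implicit.
Unset Printing Implicit Defensive.

Import GRing.Theory.

(** Extend the signature to an antiperiodic sequence S, S(k + m) = ~ S(k).
    Consecutive vertices of the j-th Hamilton cycle have sum 2j or 2j + 1, so
    the direction of an arc depends only on the midpoint of its ends: for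
    integers x < y < x + 2m there is an arc x -> y iff S(floor((x + y)/2)) is
    the parity of x + y, and * -> x iff S(x) ([walecki_pt],
    [walecki_to_pt]).

    A Walecki tournament is regular.  Hence, if x -> y lies in a unique directed
    triangle, with third vertex t, then x and y have the same relation to every
    other vertex except t ([unique_triangle_twins]).  This relation between
    {x, y} and t, called [twins_but], is preserved by isomorphisms.  Through the
    midpoint rule it becomes a system of equations on S, and solving it
    ([twins_class]) shows that t = *, up to two exceptions:
    - m = 5, one of x, y is * and the other is some p, and t = p - 1;
    - m is even, {x, y} = {p, p + m - 1}, t = p + m and S is constant on
      p, ..., p + m - 1.
    When {x, y} = {p, p + d}, 0 < d <= m and t is not *, an even d is excluded
    by the parity of the number of failing equations ([twin_even]), and an odd d
    forces S to be constant on long intervals ([twin_odd]); pairs containing *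
    yield Thue-Morse-like recurrences ([twin_star]), which contradict
    antiperiodicity unless m = 5.

    If t = * for the given arc and f does not fix *, then the image of the arc
    is exceptional, so, exchanging f and its inverse, it suffices that f fixes *
    when the source has an exceptional pair ([star_fixed]).  In the first
    exception the antipodal pair {*, p + m} is exceptional too, with third
    vertex p + m - 1, and both images cannot be accounted for unless f fixes *.
    In the second, * is the third vertex for both {p - 1, p + 1} and
    {p - 2, p + 2}, whereas a vertex other than * is the third vertex of at most
    one pair. *)

(** * Equations on antiperiodic sequences *)

(** Moving a window of length m one step trades s c for s (c + m), its
    negation. *)
Lemma antiperiodic_window_parity m (s : nat -> bool) c :
  (forall k, s (k + m) = ~~ s k) ->
  \big[addb/false]_(k < m) s (k + c) = \big[addb/false]_(k < m) s k (+) odd c.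
Proof.
move=> sm; elim: c => [|c IHc].
  by rewrite addbF; apply: eq_bigr => k _; rewrite addn0.
have : s c (+) \big[addb/false]_(k < m) s (k + c.+1)
       = \big[addb/false]_(k < m) s (k + c) (+) ~~ s c.
  transitivity (\big[addb/false]_(k < m.+1) s (k + c)).
    rewrite big_ord_recl; congr (_ (+) _).
    by apply: eq_bigr => k _; rewrite /= /bump addnS.
  by rewrite big_ord_recr /= [m + c]addnC sm.
rewrite IHc /=; move: (\big[_/_]_(_ < _) s _) (\big[_/_]_(_ < _) s (_ + _)).
by move=> [] []; case: (s c); case: (odd c).
Qed.

Lemma parity_below m c : c <= m -> \big[addb/false]_(k < m) (k < c) = odd c.
Proof.
elim: m c => [|m IHm] c lecm; first by rewrite big_ord0; case: c lecm.
rewrite big_ord_recr /=; have [lecm'|ltmc] := leqP c m.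
  by rewrite IHm // addbF.
have -> : c = m.+1 by lia.
rewrite (eq_bigr (fun k : 'I_m => k < m)) => [|k _]; last first.
  by have := ltn_ord k; lia.
by rewrite IHm // addbT.
Qed.

(** Here and in the next two lemmas the universally quantified hypothesis is the
    relation [twins_but] expressed through the midpoint rule, z being the offset
    of a vertex from the first element of the pair and t that of the third
    vertex.  For the pair of offsets 0 and 2c, the equations at z = 2k and
    z = 2k + 1 coincide, and the number of k < m at which they fail is even, so
    a single failure is impossible. *)
Lemma twin_even m (s : nat -> bool) c t :
  (forall k, s (k + m) = ~~ s k) -> 0 < c -> 2 * c <= m ->
  0 < t < 2 * m -> t != 2 * c ->
  ~ (forall z, 0 < z < 2 * m -> z != 2 * c ->
     ((s z./2 == odd z)
      == ((s (z + 2 * c)./2 == odd (z + 2 * c)) (+) (z < 2 * c))) = (z != t)).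
Proof.
move=> sm c0 lecm ht tc H.
(* The equation at 2k or 2k + 1 fails. *)
pose fail k := s (k + c) (+) s k (+) (k < c).
have ev k : 0 < k < m -> k != c -> fail k = (2 * k == t).
  move=> hk kc; have := H (2 * k) ltac:(lia) ltac:(lia).
  rewrite (_ : (2 * k)./2 = k); last by lia.
  rewrite (_ : (2 * k + 2 * c)./2 = k + c); last by lia.
  rewrite (_ : odd (2 * k) = false); last by lia.
  rewrite (_ : odd (2 * k + _) = false); last by lia.
  rewrite (_ : (2 * k < 2 * c) = (k < c)); last by lia.
  by rewrite /fail; case: (_ == t); case: (s (k + c)); case: (s k);
    case: (k < c).
have od k : k < m -> fail k = ((2 * k).+1 == t).
  move=> hk; have := H (2 * k).+1 ltac:(lia) ltac:(lia).
  rewrite (_ : (2 * k).+1./2 = k); last by lia.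
  rewrite (_ : ((2 * k).+1 + 2 * c)./2 = k + c); last by lia.
  rewrite (_ : odd (2 * k).+1 = true); last by lia.
  rewrite (_ : odd (_.+1 + _) = true); last by lia.
  rewrite (_ : (_ < 2 * c) = (k < c)); last by lia.
  by rewrite /fail; case: (_ == t); case: (s (k + c)); case: (s k);
    case: (k < c).
case todd: (odd t); last first.
  have E : t = 2 * t./2 by lia.
  have := ev t./2 ltac:(lia) ltac:(lia); rewrite od; lia.
have E : t = (2 * t./2).+1 by lia.
have : \big[addb/false]_(k < m) fail k = false.
  rewrite !big_split /= parity_below; last by lia.
  rewrite antiperiodic_window_parity //.
  by move: (\big[_/_]_(_ < _) s _) => []; case: (odd c).
have lt2 : t./2 < m by lia.
rewrite (bigD1 (Ordinal lt2)) //= od // -E eqxx big1 // => k /eqP kt.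
rewrite od //; apply/negbTE/eqP => Ek; apply: kt; apply: val_inj => /=; lia.
Qed.

(** The pair of offsets 0 and 2c + 1.  The equations for z < 2c + 1 say that s is
    constant on [0, 2c], those for z > 2c + 1 that s is constant on [c + 1, m)
    with the opposite value on [2c + 1, m + c]; a single failure only leaves room
    for m = 2c + 2. *)
Lemma twin_odd m (s : nat -> bool) c t :
  (forall k, s (k + m) = ~~ s k) -> 3 <= m -> (2 * c).+1 <= m ->
  s 0 = s (2 * c).+1 ->
  (forall z, 0 < z < 2 * m -> z != (2 * c).+1 ->
     ((s z./2 == odd z)
      == ((s (z + (2 * c).+1)./2 == odd (z + (2 * c).+1)) (+) (z < (2 * c).+1)))
     = (z != t)) ->
  [/\ m = (2 * c).+2, t = m & forall k, k < m -> s k = s 0].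
Proof.
move=> sm m3 lecm s0d H.
have hev k : (2 * k)./2 = k by lia.
have hod k : ((2 * k).+1)./2 = k by lia.
have A1 k : c < k < m -> (s (k + c) == ~~ s k) = (2 * k != t).
  move=> hk; have {H} := H (2 * k) ltac:(lia) ltac:(lia).
  rewrite hev (_ : (2 * k + (2 * c).+1)./2 = k + c); last by lia.
  rewrite (_ : odd (2 * k) = false); last by lia.
  rewrite (_ : odd (2 * k + _) = true); last by lia.
  rewrite (_ : (_ < _) = false); last by lia.
  by move <-; case: (s (k + c)); case: (s k).
have A2 k : c < k < m -> (s (k + c).+1 == ~~ s k) = ((2 * k).+1 != t).
  move=> hk; have {H} := H (2 * k).+1 ltac:(lia) ltac:(lia).
  rewrite hod (_ : ((2 * k).+1 + (2 * c).+1)./2 = (k + c).+1); last by lia.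
  rewrite (_ : odd (2 * k).+1 = true); last by lia.
  rewrite (_ : odd (_ + _) = false); last by lia.
  rewrite (_ : (_ < _) = false); last by lia.
  by move <-; case: (s (k + c).+1); case: (s k).
have B1 k : 0 < k <= c -> (s (k + c) == s k) = (2 * k != t).
  move=> hk; have {H} := H (2 * k) ltac:(lia) ltac:(lia).
  rewrite hev (_ : (2 * k + (2 * c).+1)./2 = k + c); last by lia.
  rewrite (_ : odd (2 * k) = false); last by lia.
  rewrite (_ : odd (2 * k + _) = true); last by lia.
  rewrite (_ : (_ < _) = true); last by lia.
  by move <-; case: (s (k + c)); case: (s k).
have B2 k : k < c -> (s (k + c).+1 == s k) = ((2 * k).+1 != t).
  move=> hk; have {H} := H (2 * k).+1 ltac:(lia) ltac:(lia).
  rewrite hod (_ : ((2 * k).+1 + (2 * c).+1)./2 = (k + c).+1); last by lia.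
  rewrite (_ : odd (2 * k).+1 = true); last by lia.
  rewrite (_ : odd (_ + _) = false); last by lia.
  rewrite (_ : (_ < _) = true); last by lia.
  by move <-; case: (s (k + c).+1); case: (s k).
(* For c = 0 the equations at 2 and 4 both fail. *)
case: (posnP c) => [c0|c0].
  have := A1 1 ltac:(lia); have := A1 2 ltac:(lia).
  by rewrite c0 !addn0; case: (s 1); case: (s 2); lia.
have A1' k : c < k < m -> 2 * k != t -> s (k + c) = ~~ s k.
  by move=> hk kt; apply/eqP; rewrite A1.
have A2' k : c < k < m -> (2 * k).+1 != t -> s (k + c).+1 = ~~ s k.
  by move=> hk kt; apply/eqP; rewrite A2.
have [ltd|ltd] := ltnP t (2 * c).+1.
  have cA k : c < k < m -> s k = s c.+1.
    elim: k => [|k IHk] // hk; case: (eqVneq k c) => [->//|kc].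
    rewrite -IHk; last by lia.
    have h1 : s (k + c).+1 = ~~ s k by apply: A2'; lia.
    have h2 : s (k.+1 + c) = ~~ s k.+1 by apply: A1'; lia.
    by apply: negb_inj; rewrite -h1 -h2.
  have md : m = (2 * c).+1.
    apply/eqP; rewrite eqn_leq lecm leqNgt andbT; apply/negP => lt.
    have := A1 c.+1 ltac:(lia); rewrite (_ : c.+1 + c = (2 * c).+1); last by lia.
    rewrite cA; last by lia.
    by rewrite (_ : (_ != t) = true); last lia; case: (s c.+1).
  by move: (sm 0) s0d; rewrite add0n -md => -> ; case: (s 0).
have B1' k : 0 < k <= c -> s (k + c) = s k.
  by move=> hk; apply/eqP; rewrite B1 //; lia.
have B2' k : k < c -> s (k + c).+1 = s k.
  by move=> hk; apply/eqP; rewrite B2 //; lia.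
have cB k : k <= c -> s k = s 0.
  elim: k => [|k IHk] // hk; rewrite -IHk; last by lia.
  by rewrite -(B2' k) // -(B1' k.+1) // addSn.
have cB' k : k <= 2 * c -> s k = s 0.
  move=> hk; have [/cB//|ltck] := leqP k c.
  by rewrite -(subnK (ltnW ltck)) B1' ?cB //; lia.
have ltm : (2 * c).+1 < m.
  rewrite ltn_neqAle lecm andbT; apply/eqP => md.
  by move: (sm 0) s0d; rewrite add0n -md => -> ; case: (s 0).
have tE : t = (2 * c).+2.
  have := A1 c.+1 ltac:(lia); rewrite (_ : c.+1 + c = (2 * c).+1); last by lia.
  rewrite -s0d cB'; last by lia.
  by case: (s 0) => /=; lia.
have cA k : c < k < m -> s k = s 0.
  elim: k => [|k IHk] // hk; case: (eqVneq k c) => [->|kc].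
    by rewrite cB' //; lia.
  rewrite -IHk; last by lia.
  case: (eqVneq k.+1 c.+1) => [|kc']; first by lia.
  have h1 : s (k + c).+1 = ~~ s k by apply: A2'; lia.
  have h2 : s (k.+1 + c) = ~~ s k.+1 by apply: A1'; lia.
  by apply: negb_inj; rewrite -h1 -h2.
have mE : m = (2 * c).+2.
  apply/eqP; rewrite eqn_leq ltm leqNgt andbT; apply/negP => lt.
  have := A2 c.+1 ltac:(lia).
  rewrite (_ : (c.+1 + c).+1 = (2 * c).+2); last by lia.
  rewrite (cA (2 * c).+2) ?(cA c.+1); [|lia..].
  by case: (s 0) => /=; lia.
split=> //; first by rewrite tE.
move=> k hk; have [|ltk] := leqP k c; first exact: cB.
by apply: cA; lia.
Qed.

(** The pair consisting of the star and the vertex of offset 0.  Away from t the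
    equations read s (2k) = ~ s k and s (2k + 1) = s k. *)
Lemma twin_star m (s : nat -> bool) t :
  (forall k, s (k + m) = ~~ s k) -> 3 <= m ->
  (forall z, 0 < z < 2 * m -> (s z == (s z./2 == odd z)) = (z != t)) ->
  m = 5 /\ t = (2 * m).-1.
Proof.
move=> sm m3 H.
(* The equation at 2m - 1 contradicts antiperiodicity. *)
have tE : t = (2 * m).-1.
  have := H (2 * m).-1 ltac:(lia).
  rewrite (_ : (2 * m).-1./2 = m.-1); last by lia.
  rewrite (_ : odd _ = true); last by lia.
  rewrite (_ : (2 * m).-1 = m.-1 + m); last by lia.
  by rewrite sm; case: (s _) => /=; lia.
split=> //; rewrite {}tE in H.
have sev k : 0 < k < m -> s (2 * k) = ~~ s k.
  move=> hk; have := H (2 * k) ltac:(lia).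
  rewrite (_ : (2 * k)./2 = k); last by lia.
  rewrite (_ : odd _ = false); last by lia.
  rewrite (_ : (_ != _) = true); last by lia.
  by move/eqP->; case: (s k).
have sod k : k < m.-1 -> s (2 * k).+1 = s k.
  move=> hk; have := H (2 * k).+1 ltac:(lia).
  rewrite (_ : (2 * k).+1./2 = k); last by lia.
  rewrite (_ : odd _ = true); last by lia.
  rewrite (_ : (_ != _) = true); last by lia.
  by move/eqP->; case: (s k).
have s1 : s 1 = s 0 by rewrite -(sod 0) //; lia.
have s3 : s 3 = s 0 by rewrite -s1 -(sod 1) //; lia.
have sm' k : s (m + k) = ~~ s k by rewrite addnC sm.
case modd: (odd m); last first.
  pose p := m./2.
  have := sev p ltac:(lia); have := sod p ltac:(lia).
  rewrite (_ : 2 * p = m + 0); last by lia.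
  rewrite -addnS !sm' s1 => <-; by case: (s 0).
case: (eqVneq m 3) => [m3'|nm3].
  by move: (sm' 0); rewrite {1}m3' s3; case: (s 0).
apply/eqP; apply: contraT => m5.
have s4 : s 4 = s 0 by rewrite (sev 2) ?(sev 1) ?s1 ?negbK //; lia.
pose q := (m + 3)./2.
have := sev q ltac:(lia); have := sod q ltac:(lia).
rewrite (_ : 2 * q = m + 3); last by lia.
rewrite -addnS !sm' s3 s4 => <-; by case: (s 0).
Qed.

(** * Tournaments and arcs in a unique triangle *)

Section Tournaments.
Variable T : finType.
Implicit Types (e : rel T) (x y z t : T).

(** The vertices x and y dominate the same vertices outside {x, y}, except that
    they disagree on t. *)
Definition twins_but e x y t : Prop :=
  [/\ x != y, t != x, t != y
    & forall z, z != x -> z != y -> (e x z == e y z) = (z != t)].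

Lemma twins_but_sym e x y t : twins_but e x y t -> twins_but e y x t.
Proof.
case=> xy tx ty H; split=> //; first by rewrite eq_sym.
by move=> z zy zx; rewrite eq_sym H.
Qed.

(** Each vertex is joined to 2d others, so the bounds on its two degrees are
    attained and no pair is joined twice. *)
Lemma regular_tournament e d :
  #|T| = (2 * d).+1 ->
  (forall x, #|[set y | e x y]| <= d) -> (forall x, #|[set y | e y x]| <= d) ->
  (forall x y, x != y -> e x y || e y x) ->
  (forall x, #|[set y | e x y]| = d) /\ (forall x y, e x y -> ~~ e y x).
Proof.
move=> cT outd ind tot.
have key x : #|[set y | e x y]| = d /\
    [set y | e x y] :&: [set y | e y x] = set0.
  pose A := [set y | e x y]; pose B := [set y | e y x].
  have sub : ~: [set x] \subset A :|: B.
    by apply/subsetP => y; rewrite !inE eq_sym => /tot.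
  have := subset_leq_card sub; rewrite cardsC1 cT /=.
  have := cardsUI A B; have := outd x; have := ind x; rewrite -/A -/B.
  move=> hB hA hU hC; split; first by lia.
  by apply/eqP; rewrite -cards_eq0; lia.
split=> [x|x y exy]; first by have [] := key x.
have [_ /setP/(_ y)] := key x; rewrite !inE exy /= => ->; exact: isT.
Qed.

Lemma triangle_uniq e x y z :
  (forall v w, e v w -> ~~ e w v) -> e x y -> e y z -> e z x ->
  uniq [:: x; y; z].
Proof.
move=> asym xy yz zx.
have irr v : e v v = false by apply/negP => h; have := asym _ _ h; rewrite h.
rewrite /= !inE negb_or !andbT; apply/andP; split; first apply/andP; try split;
  by apply/eqP => E; move: xy yz zx; rewrite E ?irr.
Qed.

Lemma directed_triangleP e x y z :
  (forall v w, e v w -> ~~ e w v) -> e x y -> e y z -> e z x ->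
  directed_triangle e [set p | cycle_arc [:: x; y; z] p.1 p.2].
Proof.
move=> asym xy yz zx; exists [:: x; y; z]; split=> //.
by rewrite /ucycle (triangle_uniq asym) //= xy yz zx.
Qed.

Lemma cycle_arc3 x y z p q : uniq [:: x; y; z] ->
  cycle_arc [:: x; y; z] p q
  = [|| (p, q) == (x, y), (p, q) == (y, z) | (p, q) == (z, x)].
Proof.
rewrite /= !inE negb_or !andbT => /andP[/andP[xy xz] yz].
rewrite /cycle_arc !inE !xpair_eqE /= !(eq_sym _ q).
case: (eqVneq p x) => [->|px] /=.
  by rewrite (negPf xy) (negPf xz) /= !orbF.
case: (eqVneq p y) => [->|py] /=; first by rewrite (negPf yz) /= !orbF.
by case: (eqVneq p z).
Qed.

Lemma triangle_through e A x y : directed_triangle e A -> (x, y) \in A ->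
  exists z, [/\ e x y, e y z & e z x].
Proof.
move=> [[|p [|q [|r [|? ?]]]]] [] // /andP[/= /and4P[pq qr rp _] U] _ ->.
rewrite inE (@cycle_arc3 p q r) // => /or3P[] /eqP[-> ->].
- by exists r.
- by exists p.
- by exists q.
Qed.

(** The out-neighbourhoods of x and y have the same size; y dominates without x
    only the third vertex t, so x dominates without y a single vertex, which
    is y itself. *)
Lemma unique_triangle_twins e d x y :
  (forall v, #|[set w | e v w]| = d) -> (forall v w, e v w -> ~~ e w v) ->
  (forall v w, v != w -> e v w || e w v) ->
  e x y -> in_unique_triangle e (x, y) -> exists t, twins_but e x y t.
Proof.
move=> outd asym tot xy [A [[triA inA] uniqA]].
have irr v : e v v = false by apply/negP => h; have := asym _ _ h; rewrite h.
have [t [_ yt tx]] := triangle_through triA inA.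
exists t.
have uq z : e y z -> e z x -> z = t.
  have tri w : e y w -> e w x -> uniq [:: x; y; w] /\ 
     A = [set p | cycle_arc [:: x; y; w] p.1 p.2].
    move=> yw wx; have := directed_triangleP asym xy yw wx.
    move=> D; have U := triangle_uniq asym xy yw wx.
    split=> //; apply: uniqA; split=> //.
    by rewrite inE cycle_arc3 // eqxx.
  move=> yz zx; have [U1 E1] := tri z yz zx; have [U2 E2] := tri t yt tx.
  have := E1; rewrite E2 => /setP/(_ (y, z)).
  rewrite !inE !cycle_arc3 // !xpair_eqE !eqxx orbT /=.
  have /negPf-> : y != x by apply: contraTneq xy => ->; rewrite irr.
  have /negPf-> : y != t by apply: contraTneq yt => <-; rewrite irr.
  by rewrite orbF /= => /eqP.
have xt : t != x by apply: contraTneq tx => ->; rewrite irr.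
have ty : t != y by apply: contraTneq yt => ->; rewrite irr.
have nxt : e x t = false by apply/negbTE/asym.
(* A vertex dominated by y and not by x closes a triangle on x -> y. *)
have EB : [set w | e y w] :\: [set w | e x w] = [set t].
  apply/setP => z; rewrite !inE; case: (eqVneq z t) => [->|zt].
    by rewrite yt nxt.
  apply/negbTE; apply: contra zt => /andP[nxz yz]; apply/eqP/uq => //.
  have zx : x != z by apply: contraTneq yz => <-; apply: asym.
  by have := tot x z zx; rewrite (negPf nxz).
have : #|[set w | e x w] :\: [set w | e y w]| = 1.
  have := congr1 (fun B : {set T} => #|B|) EB.
  by rewrite !cardsD !outd cards1 setIC.
move/eqP/cards1P => [b Eb].
have yb : y = b by apply/set1P; rewrite -Eb !inE irr xy.
split=> //; first by apply: contraTneq xy => ->; rewrite irr.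
move=> z zx zy; have := EB => /setP/(_ z); have := Eb => /setP/(_ z).
rewrite !inE -yb (negPf zy).
by case: (e x z); case: (e y z) => //= _; case: (z == t).
Qed.

End Tournaments.

Lemma twins_but_iso (T T' : finType) (e : rel T) (e' : rel T') f x y t :
  isomorphism e e' f -> twins_but e x y t -> twins_but e' (f x) (f y) (f t).
Proof.
move=> [[g fK gK] fe] [xy tx ty H].
have finj := can_inj fK.
split; rewrite ?(inj_eq finj) // => z; rewrite -(gK z) !fe !(inj_eq finj).
exact: H.
Qed.

(** * The midpoint rule *)

Section WaleckiArcs.
Variables (m : nat) (u : m.-tuple bool).
Hypothesis m_gt0 : 0 < m.

(** The vertex labelled by the residue class of k. *)
Definition pt (k : nat) : vertex m := Some (k%:R)%R.

(** The signature as an antiperiodic sequence of period 2m: S (j + m) = ~ S j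
    reflects that the cycle j + m is the cycle j reversed. *)
Definition extended_signature (k : nat) : bool :=
  nth false u (k %% m) (+) odd (k %/ m).
Local Notation S := extended_signature.

Lemma extended_signatureD k : S (k + m) = ~~ S k.
Proof. by rewrite /S modnDr divnDr // divnn m_gt0 addn1 /= addbN. Qed.

Lemma card_vertex : #|{: vertex m}| = (2 * m).+1.
Proof. by rewrite card_option card_ord Zp_cast //; lia. Qed.

Lemma pt_eq k l : (pt k == pt l) = (k == l %[mod 2 * m]).
Proof.
have h : 1 < 2 * m by lia.
by apply/eqP/eqP => [[/(congr1 val)]|E]; rewrite /= ?val_Zp_nat //;
  congr Some; rewrite -(Zp_nat_mod h) E Zp_nat_mod.
Qed.

Lemma pt_cong k l r q : k + 2 * m * r = l + 2 * m * q -> pt k = pt l.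
Proof.
move=> E; apply/eqP; rewrite pt_eq; have := congr1 (modn^~ (2 * m)) E.
by rewrite ![2 * m * _]mulnC ![_ + _ * (2 * m)]addnC !modnMDl => ->.
Qed.

(** Any vertex but the star is pt (p + i) for an offset i < 2m, whatever p. *)
Lemma ptP p v : v = None \/ exists2 i, i < 2 * m & v = pt (p + i).
Proof.
case: v => [x|]; [right|by left].
have x2 : x < 2 * m by apply: leq_trans (ltn_ord x) _; rewrite Zp_cast //; lia.
exists ((x + 2 * m * p - p) %% (2 * m)); first by rewrite ltn_mod; lia.
rewrite -[Some x](_ : pt x = _); last by rewrite /pt natr_Zp.
apply/eqP; rewrite pt_eq modnDmr subnKC; last by nia.
by rewrite [2 * m * p]mulnC addnC modnMDl.
Qed.

(** The i-th entry of the zigzag 0, 1, -1, 2, -2, ..., m, with -k written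
    2m - k (and 0 written 2m). *)
Definition zz i := if odd i then i.+1./2 else 2 * m - i./2.

Lemma zz_even a : zz (2 * a) = 2 * m - a.
Proof. by rewrite /zz mul2n odd_double doubleK. Qed.

Lemma zz_odd a : zz (2 * a).+1 = a.+1.
Proof. by rewrite /zz mul2n /= odd_double doubleK. Qed.

Lemma zigzagE : zigzag m = mkseq (fun i => (zz i)%:R%R) (2 * m).
Proof.
have h1 : 1 < 2 * m by lia.
have flat k : k < m ->
    (0%R : 'Z_(2 * m)) :: flatten [seq [:: i%:R; - i%:R]%R | i <- iota 1 k]
    = mkseq (fun i => (zz i)%:R%R) (2 * k).+1.
  elim: k => [|k IHk] hk.
    by rewrite /mkseq /= /zz /= subn0 pchar_Zp.
  have -> : iota 1 k.+1 = iota 1 k ++ [:: k.+1].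
    by rewrite -{1}[k.+1]addn1 iotaD add1n.
  rewrite map_cat flatten_cat -cat_cons IHk; last by lia.
  rewrite mulnS !addSn add0n !mkseqS -!cats1 -!catA; congr (_ ++ _) => /=.
  rewrite /zz (_ : odd (2 * k).+1 = true); last by lia.
  rewrite (_ : odd (2 * k).+2 = false); last by lia.
  rewrite (_ : (2 * k).+2./2 = k.+1); last by lia.
  congr [:: _; _; _]; rewrite natrB; last by lia.
  by rewrite pchar_Zp ?sub0r.
rewrite /zigzag -cat_cons flat; last by lia.
rewrite -(_ : (2 * m.-1).+2 = 2 * m); last by lia.
rewrite [RHS]mkseqS -cats1; congr (_ ++ [:: _]).
rewrite /zz (_ : odd _ = true); last by lia.
by congr (_%:R)%R; lia.
Qed.

(** The vertices of the j-th Hamilton cycle, in order from the star. *)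
Definition cyc j := None :: mkseq (fun i => pt (zz i + j)) (2 * m).

Lemma shiftC0 j : map (shift (j%:R)%R) (C0 m) = cyc j.
Proof.
rewrite /C0 zigzagE /= /cyc /mkseq -!map_comp; congr cons.
apply: eq_map => i /=.
by rewrite /pt natrD.
Qed.

Lemma uniq_cyc j : uniq (cyc j).
Proof.
rewrite /= (_ : None \notin _); last by apply/mapP => -[].
apply/mkseq_uniqP => i k; rewrite !inE /zz => hi hk /eqP.
rewrite pt_eq eqn_modDr => /eqP.
by case: ifP => oi; case: ifP => ok; (try case: (posnP i) => [i0|i0]);
  (try case: (posnP k) => [k0|k0]); 
  rewrite ?i0 ?k0 /= ?subn0 ?modnn ?modn_small; lia.
Qed.

Lemma next_cyc j i : i <= 2 * m -> 
  next (cyc j) (nth None (cyc j) i) = nth None (behead (cyc j)) i.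
Proof.
move=> hi; have si : i < size (cyc j) by rewrite /= size_mkseq.
by rewrite next_nth mem_nth // index_uniq ?uniq_cyc //; case: (i) si.
Qed.

Lemma next_cyc_pt j i : i < 2 * m ->
  next (cyc j) (pt (zz i + j)) = nth None (behead (cyc j)) i.+1.
Proof.
move=> hi; rewrite -next_cyc //; congr (next _ _).
by rewrite /= nth_mkseq.
Qed.

Lemma mem_cyc j i : i < 2 * m -> pt (zz i + j) \in cyc j.
Proof. by move=> hi; rewrite inE; apply/mapP; exists i; rewrite ?mem_iota. Qed.

(** The arc between x and y, from x to y iff b. *)
Definition dir (b : bool) x y := if b then walecki u x y else walecki u y x.

Lemma dir_cyc (j : nat) x y : j < m ->
  x \in cyc j -> next (cyc j) x = y -> dir (nth false u j) x y.
Proof.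
move=> jm xj nxy; rewrite /dir.
have C : Cplus (j%:R)%R x y by rewrite /Cplus /cycle_arc shiftC0 xj nxy eqxx.
by case: ifP => uj; apply/existsP; exists (Ordinal jm);
  rewrite (tnth_nth false) /= uj.
Qed.

Lemma dir_inner (j i : nat) : j < m -> i.+1 < 2 * m ->
  dir (nth false u j) (pt (zz i + j)) (pt (zz i.+1 + j)).
Proof.
move=> jm im; apply: dir_cyc => //.
  by apply: mem_cyc; lia.
by rewrite next_cyc_pt /= ?nth_mkseq //; lia.
Qed.

Lemma dir_first (j : nat) : j < m -> dir (nth false u j) None (pt j).
Proof.
move=> jm; apply: dir_cyc; rewrite ?inE //.
have := @next_cyc j 0 ltac:(lia); rewrite /= nth_mkseq ?muln_gt0 // => ->.
by apply: (@pt_cong _ _ 0 1); rewrite /zz /=; lia.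
Qed.

Lemma dir_last (j : nat) : j < m -> dir (nth false u j) (pt (m + j)) None.
Proof.
move=> jm; have E : m + j = zz (2 * m).-1 + j.
  by rewrite /zz (_ : odd _ = true); lia.
apply: dir_cyc => //.
  by rewrite E mem_cyc //; lia.
rewrite E next_cyc_pt; last by lia.
by rewrite nth_default //= size_mkseq prednK // muln_gt0.
Qed.

Lemma dirN b x y : dir (~~ b) x y = dir b y x.
Proof. by case: b. Qed.

(** Write h = j + q m with j < m for the midpoint h.  If q is even the arc is
    read off the cycle j at h; if q is odd, x and y are symmetric about j + m and
    are met in the opposite order. *)
Lemma arc_pt x y : x < y -> y < x + 2 * m ->
  dir (S (x + y)./2 == odd (x + y)) (pt x) (pt y).
Proof.
move=> xy yx; set h := (x + y)./2; pose j := h %% m; pose r := (h %/ m)./2.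
have jm : j < m by rewrite ltn_mod.
have hE : h = 2 * m * r + m * odd (h %/ m) + j.
  rewrite {1}(divn_eq h m) -{1}(odd_double_half (h %/ m)) -/r -/j -mul2n; nia.
rewrite /S -/j.
have [ox|/negPf ex] := boolP (odd (x + y));
  have [oq|/negPf eq] := boolP (odd (h %/ m)).
- rewrite eqb_id addbT dirN; pose b := m - (h - x) - 1.
  have := @dir_inner j (2 * b) jm ltac:(lia); rewrite zz_even zz_odd.
  have -> : pt (2 * m - b + j) = pt y by apply: (@pt_cong _ _ r 0); lia.
  by have -> : pt (b.+1 + j) = pt x by apply: (@pt_cong _ _ r 0); lia.
- rewrite eqb_id addbF; pose b := h - x.
  have := @dir_inner j (2 * b) jm ltac:(lia); rewrite zz_even zz_odd.
  have -> : pt (2 * m - b + j) = pt x by apply: (@pt_cong _ _ r 1); lia.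
  by have -> : pt (b.+1 + j) = pt y by apply: (@pt_cong _ _ r 0); lia.
- rewrite eqbF_neg addbT negbK; pose b := m - (h - x) - 1.
  have := @dir_inner j (2 * b).+1 jm ltac:(lia).
  rewrite zz_odd -[(2 * b).+2](mulnDr 2 1 b) zz_even.
  have -> : pt (2 * m - (1 + b) + j) = pt y by apply: (@pt_cong _ _ r 0); lia.
  by have -> : pt (b.+1 + j) = pt x by apply: (@pt_cong _ _ r 0); lia.
- rewrite eqbF_neg addbF dirN; pose b := h - x - 1.
  have := @dir_inner j (2 * b).+1 jm ltac:(lia).
  rewrite zz_odd -[(2 * b).+2](mulnDr 2 1 b) zz_even.
  have -> : pt (2 * m - (1 + b) + j) = pt x by apply: (@pt_cong _ _ r 1); lia.
  by have -> : pt (b.+1 + j) = pt y by apply: (@pt_cong _ _ r 0); lia.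
Qed.

Lemma arc_star x : dir (S x) None (pt x).
Proof.
pose j := x %% m; pose r := (x %/ m)./2.
have jm : j < m by rewrite ltn_mod.
have xE : x = 2 * m * r + m * odd (x %/ m) + j.
  rewrite {1}(divn_eq x m) -{1}(odd_double_half (x %/ m)) -/r -/j -mul2n; nia.
rewrite /S -/j; have [oq|/negPf eq] := boolP (odd (x %/ m)).
  rewrite addbT dirN.
  have -> : pt x = pt (m + j) by apply: (@pt_cong _ _ 0 r); lia.
  exact: dir_last.
rewrite addbF.
have -> : pt x = pt j by apply: (@pt_cong _ _ 0 r); lia.
exact: dir_first.
Qed.

Lemma walecki_total x y : x != y -> walecki u x y || walecki u y x.
Proof.
have dirW b v w : dir b v w -> walecki u v w || walecki u w v.
  by case: b => /= ->; rewrite ?orbT.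
have [->|[i hi ->]] := ptP 0 x;
  have [->|[k hk ->]] := ptP 0 y; rewrite // !add0n.
- by move=> _; apply: dirW (arc_star k).
- by move=> _; rewrite orbC; apply: dirW (arc_star i).
case: (ltngtP i k) => [ik|ki|->]; last by rewrite eqxx.
- by move=> _; apply: dirW (@arc_pt i k ik _); lia.
- by move=> _; rewrite orbC; apply: dirW (@arc_pt k i ki _); lia.
Qed.

(** Each Hamilton cycle contributes one successor and one predecessor. *)
Lemma walecki_degree x :
  #|[set y | walecki u x y]| <= m /\ #|[set y | walecki u y x]| <= m.
Proof.
have step (j : 'I_m) v w : Cplus (j%:R)%R v w ->
    next (cyc j) v = w /\ prev (cyc j) w = v.
  rewrite /Cplus /cycle_arc shiftC0 => /andP[_ /eqP <-].
  by rewrite prev_next ?uniq_cyc.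
have bound (F : 'I_m -> vertex m) (A : {set vertex m}) :
    (forall y, y \in A -> exists j, y = F j) -> #|A| <= m.
  move=> AF; rewrite -[X in _ <= X]card_ord -cardsT.
  apply: leq_trans (leq_imset_card F [set: 'I_m]).
  apply/subset_leq_card/subsetP => y /AF[j ->].
  exact: imset_f.
split.
  apply: (bound (fun j => if tnth u j then next (cyc j) x else prev (cyc j) x)).
  move=> y; rewrite inE => /existsP[j hj]; exists j; move: hj.
  by case: ifP => _ /step[].
apply: (bound (fun j => if tnth u j then prev (cyc j) x else next (cyc j) x)).
move=> y; rewrite inE => /existsP[j hj]; exists j; move: hj.
by case: ifP => _ /step[].
Qed.

Lemma walecki_regular :
  (forall x, #|[set y | walecki u x y]| = m) /\
  (forall x y, walecki u x y -> ~~ walecki u y x).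
Proof.
apply: regular_tournament walecki_total.
- exact: card_vertex.
- by move=> x; case: (walecki_degree x).
- by move=> x; case: (walecki_degree x).
Qed.

Lemma dirE b x y : dir b x y -> walecki u x y = b /\ walecki u y x = ~~ b.
Proof.
have [_ asym] := walecki_regular.
by case: b => /= h; rewrite h; split=> //; apply/negbTE/asym.
Qed.

Lemma walecki_pt x y : x < y -> y < x + 2 * m ->
  walecki u (pt x) (pt y) = (S (x + y)./2 == odd (x + y)).
Proof. by move=> xy yx; case: (dirE (arc_pt xy yx)). Qed.

Lemma walecki_ptV x y : x < y -> y < x + 2 * m ->
  walecki u (pt y) (pt x) = (S (x + y)./2 != odd (x + y)).
Proof. by move=> xy yx; case: (dirE (arc_pt xy yx)). Qed.

Lemma walecki_to_pt x : walecki u None (pt x) = S x.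
Proof. by case: (dirE (arc_star x)). Qed.

Lemma walecki_from_pt x : walecki u (pt x) None = ~~ S x.
Proof. by case: (dirE (arc_star x)). Qed.

(** * Classification of twin pairs *)

Lemma pt_eqD p i k : i < 2 * m -> k < 2 * m ->
  (pt (p + i) == pt (p + k)) = (i == k).
Proof. by move=> hi hk; rewrite pt_eq eqn_modDl !modn_small. Qed.

Lemma pt_eqD0 p i : i < 2 * m -> (pt (p + i) == pt p) = (i == 0).
Proof. by move=> hi; have := @pt_eqD p i 0 hi; rewrite addn0; apply; lia. Qed.

Lemma walecki_base p z : 0 < z < 2 * m ->
  walecki u (pt p) (pt (p + z)) = (S (p + z./2) == odd z).
Proof.
move=> hz; rewrite walecki_pt; try lia.
rewrite (_ : (p + (p + z))./2 = p + z./2); last by lia.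
by rewrite (_ : odd (p + (p + z)) = odd z); last by lia.
Qed.

Lemma walecki_offset p d z : 0 < d < 2 * m -> 0 < z < 2 * m -> z != d ->
  walecki u (pt (p + d)) (pt (p + z))
  = (S (p + (z + d)./2) == odd (z + d)) (+) (z < d).
Proof.
move=> hd hz zd.
have Eh : (p + z + (p + d))./2 = p + (z + d)./2 by lia.
have Eo : odd (p + z + (p + d)) = odd (z + d) by lia.
case: (ltngtP z d) zd => // ltzd _.
  by rewrite walecki_ptV ?Eh ?Eo ?addbT //; lia.
by rewrite walecki_pt 1?addnC ?Eh ?Eo ?addbF //; lia.
Qed.

Hypothesis m_ge3 : 3 <= m.

Lemma twins_star p t : twins_but (walecki u) None (pt p) t ->
  m = 5 /\ t = pt (p + (2 * m).-1).
Proof.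
case=> _; have [->|[i hi ->]] := ptP p t => // _ tp H.
have i0 : 0 < i by case: i tp {hi H} => //; rewrite addn0 eqxx.
have [||m5 <-] := @twin_star m (fun k => S (p + k)) i _ m_ge3.
- by move=> k; rewrite addnA extended_signatureD.
- move=> z hz; have := H (pt (p + z)) isT.
  rewrite pt_eqD0; last by lia.
  rewrite pt_eqD; try lia.
  by rewrite walecki_to_pt walecki_base // => <-; lia.
by [].
Qed.

Lemma twins_pair p d t : 0 < d <= m ->
  twins_but (walecki u) (pt p) (pt (p + d)) t ->
  t = None \/
  [/\ ~~ odd m, d = m.-1, t = pt (p + m) & forall k, k < m -> S (p + k) = S p].
Proof.
move=> hd [_ tp td H]; have [->|[i hi Et]] := ptP p t; [by left|right].
have {}tp : i != 0 by rewrite -(@pt_eqD0 p) -?Et.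
have {}td : i != d by rewrite -(@pt_eqD p) -?Et //; lia.
pose s k := S (p + k).
have sm k : s (k + m) = ~~ s k by rewrite /s addnA extended_signatureD.
have s0d : s 0 = s d.
  have := H None isT isT; rewrite Et !walecki_from_pt /s addn0.
  by case: (S p); case: (S _).
have Hz z : 0 < z < 2 * m -> z != d ->
  ((s z./2 == odd z) == ((s (z + d)./2 == odd (z + d)) (+) (z < d))) = (z != i).
  move=> hz zd; have := H (pt (p + z)).
  rewrite walecki_base // walecki_offset //; last by lia.
  rewrite Et !pt_eqD ?pt_eqD0 //; try lia.
  by apply; lia.
have [od|ed] := boolP (odd d).
  have Ed : d = (2 * d./2).+1 by lia.
  have [|||E1 E2 E3] := @twin_odd m s d./2 i sm m_ge3;
    rewrite -?Ed //; first by lia.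
  split; [lia|lia|by rewrite Et E2|].
  by move=> k /E3; rewrite /s addn0.
have Ed : d = 2 * d./2 by lia.
by case: (@twin_even m s d./2 i sm); rewrite -?Ed //; lia.
Qed.

(** The exceptional third vertex of the second case is p + 2m - 1, that is
    p - 1. *)
Lemma twins_class x y t : twins_but (walecki u) x y t ->
  [\/ t = None,
      m = 5 /\ exists p, t = pt (p + (2 * m).-1) /\
        ((x = None /\ y = pt p) \/ (x = pt p /\ y = None))
    | ~~ odd m /\ exists p, [/\ t = pt (p + m),
        (x = pt p /\ y = pt (p + m.-1)) \/ (x = pt (p + m.-1) /\ y = pt p)
        & forall k, k < m -> S (p + k) = S p]].
Proof.
have [->|[a _ ->]] := ptP 0 x; rewrite ?add0n.
  have [->|[b _ ->]] := ptP 0 y; first by case; rewrite eqxx.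
  rewrite add0n => /twins_star[m5 Et]; constructor 2; split=> //.
  by exists b; split=> //; left.
have [->|[d hd ->]] := ptP a y.
  move=> /twins_but_sym/twins_star[m5 Et]; constructor 2; split=> //.
  by exists a; split=> //; right.
move=> tw; have d0 : 0 < d.
  by case: tw => + _ _ _; rewrite eq_sym pt_eqD0 // lt0n.
have [ledm|ltmd] := leqP d m.
  have [->|[em dm Et cS]] := @twins_pair a d t ltac:(lia) tw.
    by constructor 1.
  constructor 3; split=> //; exists a; split=> //; left; by rewrite dm.
have Ea : pt a = pt (a + d + (2 * m - d)) by apply: (@pt_cong _ _ 1 0); lia.
rewrite Ea in tw *; move: (twins_but_sym tw) => tw'.
have [->|[em dm Et cS]] := @twins_pair (a + d) (2 * m - d) t ltac:(lia) tw'.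
  by constructor 1.
by constructor 3; split=> //; exists (a + d); split=> //; right; rewrite dm.
Qed.

(** Adding m to all residues complements S. *)
Lemma twins_star_antipode p i :
  twins_but (walecki u) None (pt p) (pt (p + i)) ->
  twins_but (walecki u) None (pt (p + m)) (pt (p + m + i)).
Proof.
have shift_eq a b :
    (pt (p + m + a) == pt (p + m + b)) = (pt (p + a) == pt (p + b)).
  by rewrite !pt_eq -!addnA !eqn_modDl.
case=> _ _ tp H; split=> //.
  by rewrite -[in X in _ != X](addn0 (p + m)) shift_eq addn0.
move=> v; have [->|[z hz ->]] := ptP (p + m) v => // _.
rewrite -[in X in _ != X -> _](addn0 (p + m)) !shift_eq addn0 => zp.
have z0 : 0 < z by case: z zp {hz} => //; rewrite addn0 eqxx.
rewrite -(H (pt (p + z))) // !walecki_to_pt !walecki_base; try lia.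
rewrite !(addnAC p m) !extended_signatureD.
by case: (S _); case: (S _); case: (odd z).
Qed.

(** If S is constant on [p, p + m), then p - c and p + c are twins but for the
    star. *)
Lemma twins_constant p c : (forall k, k < m -> S (p + k) = S p) -> 0 < c < m ->
  twins_but (walecki u) (pt (p + (2 * m - c))) (pt (p + c)) None.
Proof.
move=> cS hc; set q := p + (2 * m - c).
have Ec : pt (p + c) = pt (q + 2 * c).
  by apply: (@pt_cong _ _ 1 0); rewrite /q; lia.
have lo k : k < c -> S (q + k) = ~~ S p.
  move=> kc; rewrite -(cS (m - c + k)); last by lia.
  by rewrite -extended_signatureD; congr S; rewrite /q; lia.
have hi k : c <= k < m + c -> S (q + k) = S p.
  move=> kc; rewrite -(cS (k - c)); last by lia.
  rewrite -[RHS]negbK -!extended_signatureD; congr S; rewrite /q; lia.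
split; rewrite ?Ec //; first by rewrite eq_sym pt_eqD0; lia.
move=> v; have [-> _ _|[z hz ->]] := ptP q v.
  rewrite !walecki_from_pt hi; last by lia.
  by rewrite -(addn0 q) lo; [case: (S p)|lia].
rewrite pt_eqD0 // pt_eqD //; last by lia.
move=> z0 zd; rewrite walecki_base; last by lia.
rewrite walecki_offset //; try lia.
rewrite (_ : (z + 2 * c)./2 = z./2 + c); last by lia.
rewrite (_ : odd (z + 2 * c) = odd z); last by lia.
rewrite (hi (z./2 + c)); last by lia.
have [ltzc|lecz] := ltnP z (2 * c).
  by rewrite lo; [case: (S p); case: (odd z)|lia].
by rewrite hi; [rewrite addbF eqxx|lia].
Qed.

End WaleckiArcs.

(** * Isomorphisms fix the star *)

(** An isomorphism whose source has an exceptional pair x, y fixes the star. *)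
Lemma star_fixed m (u v : m.-tuple bool) f x y t : 3 <= m ->
  isomorphism (walecki u) (walecki v) f ->
  twins_but (walecki u) x y t -> t <> None -> f None = None.
Proof.
move=> m3 fiso; have m0 : 0 < m by lia.
have finj : injective f by case: fiso => /bij_inj.
move=> tw tN; apply/eqP; apply: contraT => /eqP fN.
case: (twins_class m0 m3 tw) => // -[].
  move=> m5 [p [Et xy]].
  have {xy tw} tw : twins_but (walecki u) None (pt m p) (pt m (p + (2 * m).-1)).
    by case: xy tw => -[-> ->]; rewrite Et // => /twins_but_sym.
  have tw' := twins_star_antipode m0 m3 tw.
  (* An image pair omitting the star has the star as third vertex. *)
  have img a b : twins_but (walecki u) None (pt m a) (pt m b) ->
      f (pt m a) = None \/ f (pt m b) = None.
    move=> /(twins_but_iso fiso) /(twins_class m0 m3)[]; first by right.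
      by case=> _ [q [_ [] [] //]]; left.
    by case=> /negP om _; case: om; rewrite m5.
  have same a b : f (pt m a) = None -> f (pt m b) = None -> a = b %[mod 2 * m].
    by move=> fa fb; apply/eqP; rewrite -pt_eq //;
      apply/eqP/finj; rewrite fa fb.
  by case: (img _ _ tw) => h1; case: (img _ _ tw') => h2;
    move: (same _ _ h1 h2); rewrite m5; lia.
move=> om [p [_ _ cS]].
have img c : 0 < c < m -> exists q, f None = pt m (q + m) /\
    ((f (pt m (p + (2 * m - c))) = pt m q /\ f (pt m (p + c)) = pt m (q + m.-1))
  \/ (f (pt m (p + (2 * m - c))) = pt m (q + m.-1) /\
      f (pt m (p + c)) = pt m q)).
  move=> hc; have /(twins_but_iso fiso) := twins_constant m0 m3 cS hc.
  move/(twins_class m0 m3) => [//|[m5]|[_ [q [Eq ends _]]]].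
    by case/negP: om; rewrite m5.
  by exists q.
have [q1 [E1 ends1]] := img 1 ltac:(lia).
have [q2 [E2 ends2]] := img 2 ltac:(lia).
have Eq : pt m q1 = pt m q2 /\ pt m (q1 + m.-1) = pt m (q2 + m.-1).
  move: E1; rewrite E2 => /eqP; rewrite pt_eq // eqn_modDr => /eqP E.
  by split; apply/eqP; rewrite pt_eq // ?eqn_modDr E.
have same a b : f (pt m (p + a)) = f (pt m (p + b)) ->
    a < 2 * m -> b < 2 * m -> a = b.
  by move=> /finj/eqP E ha hb; apply/eqP; rewrite -(pt_eqD m0 p ha hb).
case: Eq ends1 ends2 => <- <- [] [e1 _] [] [e2 e2'].
- by have := same _ _ (etrans e1 (esym e2)); lia.
- by have := same _ _ (etrans e1 (esym e2')); lia.
- by have := same _ _ (etrans e1 (esym e2')); lia.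
- by have := same _ _ (etrans e1 (esym e2)); lia.
Qed.

Lemma isomorphism_inv (T T' : finType) (e : rel T) (e' : rel T') f :
  isomorphism e e' f -> exists2 g, isomorphism e' e g & cancel g f.
Proof.
case=> -[g fK gK] fe; exists g => //; split; first by exists f.
by move=> x y; rewrite -fe !gK.
Qed.

Unset Implicit Arguments.

Theorem corollary6p2 (m : nat) (hm : 7 <= 2 * m + 1) (u : m.-tuple bool)
    (a : vertex m * vertex m)
    (ha : walecki u a.1 a.2)
    (ha_unique : in_unique_triangle (walecki u) a) :
  (forall f : vertex m -> vertex m,
     automorphism (walecki u) f -> f None = None)
  /\ (forall (v : m.-tuple bool) (f : vertex m -> vertex m),
        isomorphism (walecki u) (walecki v) f -> f None = None).
Proof.
have m3 : 3 <= m by lia.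
have m0 : 0 < m by lia.
suff main (v : m.-tuple bool) f :
    isomorphism (walecki u) (walecki v) f -> f None = None.
  by split=> [f|]; [apply: main|exact: main].
move=> fiso; have [outd asym] := walecki_regular u m0.
case: a ha ha_unique => x y /= xy tri.
have [t tw] := unique_triangle_twins outd asym (walecki_total u m0) xy tri.
have [tN|/eqP tN] := eqVneq t None; last exact: star_fixed m3 fiso tw tN.
apply/eqP; apply: contraT => /eqP fN.
have [g giso gK] := isomorphism_inv fiso.
have tw' := twins_but_iso fiso tw; rewrite tN in tw'.
have gN := star_fixed m3 giso tw' fN.
by case: fN; rewrite -{1}gN gK.
Qed.
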